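(* Let $\ell_1,\ell_2\in\mathbb{N}\setminus\{1\}$ satisfy $\gcd(\ell_1,\ell_2)=1$, and let $$p(x,y)=q(x,y)\bigl(x^{\ell_1}-y^{\ell_2}\bigr),\qquad q(x,y)\in\{x,y,xy\}.$$ Define $$f(x,y):=\begin{cases}x, & \text{if }q=x,\ \ell_1\text{ is odd, and }\ell_2\text{ is even},\\ xy^2, & \text{if }q\in\{y,xy\},\ \ell_1\text{ is odd, and }\ell_2\text{ is even},\\ y, & \text{if }q=y,\ \ell_1\text{ is even, and }\ell_2\text{ is odd},\\ x^2y, & \text{if }q\in\{x,xy\},\ \ell_1\text{ is even, and }\ell_2\text{ is odd},\\ xy, & \text{if }\ell_1\text{ and }\ell_2\text{ are both odd}.\end{cases}$$ Then $f$ is nonnegative on $\mathcal{Z}_p$, but $f\notin\Sigma_{\{1,p,-p\},n}$ for every $n\in\mathbb{N}$. Equivalently, the class of $f$ is not a sum of squares in the coordinate ring $\mathbb{R}[x,y]/(p)$.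
   Context: Here $\mathbb{N}=\{1,2,\ldots\}$ and $\mathcal{Z}_p=\{(x,y)\in\mathbb{R}^2:p(x,y)=0\}$. For $Q=\{q_0:=1,q_1,\ldots,q_m\}\subset\mathbb{R}[x,y]$, the $n$-th truncated quadratic module generated by $Q$ is $$\Sigma_{Q,n}:=\left\{\sum_{i=0}^m\sum_{j=1}^{N_i}q_if_{ij}^2:\ N_i\in\mathbb{N}\cup\{0\},\ f_{ij}\in\mathbb{R}[x,y],\ \deg(q_if_{ij}^2)\le 2n\right\}.$$ *)

(* Defs.v *)
From HB Require Import structures.
From mathcomp Require Import all_boot all_order all_algebra.
From mathcomp Require Import boolp reals.
From mathcomp Require Import mpoly.
Set Implicit Arguments.
Unset Strict Implicit.
Unset Printing Implicit Defensive.
Import Order.TTheory GRing.Theory Num.Theory.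
Local Open Scope ring_scope.
Local Open Scope quotient_scope.

Section Bivariate.
Variable R : realType.
Local Notation P := {mpoly R[2]}.

Definition varX : P := 'X_ord0.
Definition varY : P := 'X_ord_max.

Definition eval2 (g : P) (v : R * R) : R := g.@[tnth [tuple v.1; v.2]].

Definition zero_set (p : P) : {pred R * R} := [pred v | eval2 p v == 0].

(* Q lists q_1, ..., q_m only; q_0 = 1 is prepended here.  The bound on msize,
   which is one more than the total degree and is 0 at 0, says
   deg (q_i f_ij^2) <= 2n with deg 0 = -oo. *)
Definition trunc_qmodule (Q : seq P) (n : nat) (g : P) : Prop :=
  let q := 1 :: Q in
  exists F : 'I_(size q) -> seq P,
    (forall i h, h \in F i -> (msize (q`_i * h ^+ 2) <= (2 * n).+1)%N) /\
    g = \sum_(i < size q) \sum_(h <- F i) q`_i * h ^+ 2.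

Definition pideal (p : P) : {pred P} := fun g => `[< exists h, g = h * p >].

Lemma pidealP p g : reflect (exists h, g = h * p) (g \in pideal p).
Proof. exact: asboolP. Qed.

Lemma pideal_zmod_closed p : zmod_closed (pideal p).
Proof.
split=> [|g h /pidealP[a ->] /pidealP[b ->]]; apply/pidealP.
  by exists 0; rewrite mul0r.
by exists (a - b); rewrite mulrBl.
Qed.
HB.instance Definition _ p :=
  GRing.isZmodClosed.Build P (pideal p) (pideal_zmod_closed p).

(* The library's ring quotients {ideal_quot I} demand a proper ideal, which (p)
   is not for every p, so only the additive quotient is taken from there. *)
Definition coord_ring (p : P) : Type := Quotient.quot (pideal p).
HB.instance Definition _ p := ZmodQuotient.on (coord_ring p).

Section Ring.
Variable p : P.
Local Notation A := (coord_ring p).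

Lemma coord_eqP (g h : P) :
  \pi_A g = \pi_A h <-> exists k, g - h = k * p.
Proof.
split=> [e|/pidealP]; first by apply/pidealP; rewrite Quotient.idealrBE e.
by rewrite Quotient.idealrBE => /eqP.
Qed.

Definition coord_one : A := lift_cst A 1.
Definition coord_mul := lift_op2 A *%R.
Canonical coord_one_morph := PiConst coord_one.

Lemma coord_piM : {morph \pi_A : g h / g * h >-> coord_mul g h}.
Proof.
move=> g h; unlock coord_mul; apply/coord_eqP.
have /coord_eqP[a ea] : \pi_A g = \pi_A (repr (\pi_A g)) by rewrite reprK.
have /coord_eqP[b eb] : \pi_A h = \pi_A (repr (\pi_A h)) by rewrite reprK.
set g' := repr _ in ea *; set h' := repr _ in eb *.
exists (a * h + g' * b).
rewrite mulrDl -mulrA (mulrC h) mulrA -ea -mulrA -eb.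
by rewrite mulrBl mulrBr addrA subrK.
Qed.
Canonical coord_mul_morph := PiMorph2 coord_piM.

Lemma coord_mulA : associative coord_mul.
Proof.
by move=> a b c; rewrite -[a]reprK -[b]reprK -[c]reprK !piE mulrA.
Qed.

Lemma coord_mulC : commutative coord_mul.
Proof. by move=> a b; rewrite -[a]reprK -[b]reprK !piE mulrC. Qed.

Lemma coord_mul1 : left_id coord_one coord_mul.
Proof. by move=> a; rewrite -[a]reprK !piE mul1r. Qed.

Lemma coord_mulDl : left_distributive coord_mul +%R.
Proof.
move=> a b c; rewrite -[a]reprK -[b]reprK -[c]reprK.
by rewrite !piE mulrDl.
Qed.

HB.instance Definition _ := GRing.Zmodule_isComPzRing.Build A
  coord_mulA coord_mulC coord_mul1 coord_mulDl.

End Ring.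

Definition pclass (p g : P) : coord_ring p := \pi_(coord_ring p) g.

Lemma pclass_is_zmod_morphism p : zmod_morphism (pclass p).
Proof. exact: (@raddfB P (Quotient.quot (pideal p)) \pi). Qed.
HB.instance Definition _ p :=
  GRing.isZmodMorphism.Build P (coord_ring p) (pclass p)
    (pclass_is_zmod_morphism p).

Lemma pclass_is_monoid_morphism p : monoid_morphism (pclass p).
Proof.
split=> [|g h]; last exact: coord_piM.
by rewrite -[1 in RHS]/(coord_one p) /pclass !piE.
Qed.
HB.instance Definition _ p :=
  GRing.isMonoidMorphism.Build P (coord_ring p) (pclass p)
    (pclass_is_monoid_morphism p).

(* For q in {x, y, xy} and coprime l1, l2: an inner else branch is the case
   q in {y, xy}, resp. q in {x, xy}, and the last one is l1, l2 both odd. *)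
Definition witness (l1 l2 : nat) (q : P) : P :=
  if odd l1 && ~~ odd l2 then
    if q == varX then varX else varX * varY ^+ 2
  else if ~~ odd l1 && odd l2 then
    if q == varY then varY else varX ^+ 2 * varY
  else varX * varY.

End Bivariate.

Arguments varX {R}.
Arguments varY {R}.

Definition sum_of_squares (A : pzSemiRingType) (a : A) : Prop :=
  exists s : seq A, a = \sum_(b <- s) b ^+ 2.

(* Main.v *)
Require Import Defs.
From HB Require Import structures.
From mathcomp Require Import all_boot all_order all_algebra.
From mathcomp Require Import boolp reals.
From mathcomp Require Import mpoly.
Set Implicit Arguments.
Unset Strict Implicit.
Unset Printing Implicit Defensive.
Import Order.TTheory GRing.Theory Num.Theory.
Local Open Scope ring_scope.

(** Nonnegativity of [f] on the zero set is a parity argument: on the curve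
    [x ^ l1 = y ^ l2] the exponents force the sign of [x], of [y] or of [x y],
    and on the coordinate axes contained in the zero set [f] vanishes.

    Both failures of sum-of-squares representability reduce to one fact: [f]
    is not congruent to a sum of squares modulo [p].  In the truncated module
    the generators [p] and [-p] only contribute multiples of [p], and squares
    in the coordinate ring lift to squares of polynomials.

    That fact is seen along a polynomial arc [T |-> (u T, v T)] through the
    origin, a singular point of the zero set.  The arc enters a region where
    [f] is negative, yet [p] vanishes along it to higher order than [f].  So a
    representation [f = sum of squares + k p] pulls back to
    [- T ^ 2m = sum of squares + (terms of order > 2m)] in [R[T]], which is
    impossible since the lowest coefficient of a sum of squares is nonnegative
    ([sumsq_low_coef_ge0], [arc_obstruction]).  Suitable arcs are [(T, -T)]
    when [l1] and [l2] are both odd ([f] has order 2 and [p] order at least 3),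
    and the cusps [(- T ^ 2, T ^ 3)] and [(T ^ 3, - T ^ 2)] when one of them is
    even: the coordinate with the odd exponent, which is nonnegative on the
    curve, is the one made negative. *)

(** Evaluation at 0 settles order 0.  In positive order the values at 0 have
    squares adding up to 0, so every summand is divisible by ['X], and a factor
    ['X ^+ 2] cancels. *)
Lemma sumsq_low_coef_ge0 (R : realFieldType) (s : seq {poly R}) (m : nat)
    (g : {poly R}) :
  \sum_(h <- s) h ^+ 2 = g * 'X^(2 * m) -> 0 <= g.[0].
Proof.
elim: m s => [|m IHm] s sE.
  rewrite muln0 expr0 mulr1 in sE.
  rewrite -sE horner_sum; apply: sumr_ge0 => h _.
  by rewrite horner_exp sqr_ge0.
have /eqP : \sum_(h <- s) h.[0] ^+ 2 = 0.
  have := congr1 (horner^~ 0) sE.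
  rewrite /= horner_sum hornerM hornerXn mulnS expr0n mulr0 => e.
  by rewrite -[RHS]e; apply: eq_bigr => h _; rewrite horner_exp.
rewrite psumr_eq0 => [/allP s0|h _]; last exact: sqr_ge0.
apply: (IHm [seq h %/ 'X | h <- s]); rewrite big_map.
apply: (@mulIf _ ('X^2)); first by rewrite expf_neq0 ?polyX_eq0.
rewrite -mulrA -exprD addnC -mulnS -sE mulr_suml.
apply: eq_big_seq => h /s0; rewrite sqrf_eq0 => h0.
by rewrite -exprMn divpK // -['X]subr0 dvdp_XsubCl.
Qed.

Section Arc.
Variable R : realType.
Local Notation P := {mpoly R[2]}.
Implicit Types (u v : {poly R}) (p f : P).

(** Restriction of polynomial functions to the arc [T |-> (u T, v T)]. *)
Definition arc u v : P -> {poly R} := mmap (@polyC R) (tnth [tuple u; v]).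

HB.instance Definition _ u v := GRing.RMorphism.on (arc u v).

Lemma arcX u v : arc u v varX = u.
Proof. by rewrite /arc mmapX mmap1U. Qed.

Lemma arcY u v : arc u v varY = v.
Proof. by rewrite /arc mmapX mmap1U. Qed.

Definition sos_mod p f : Prop :=
  exists s : seq P, exists k : P, f = \sum_(h <- s) h ^+ 2 + k * p.

(** Pulling back [f = sum of squares + k p] shows that
    [- 'X ^+ (2 m) - k' c 'X ^+ (2 m + 1)] is a sum of squares in [{poly R}],
    where [k'] is the pullback of [k] and [c] the cofactor of [p]; its
    coefficient of order [2 m] is [-1]. *)
Lemma arc_obstruction u v p f (m : nat) :
    arc u v f = - 'X^(2 * m) -> 'X^((2 * m).+1) %| arc u v p ->
  ~ sos_mod p f.
Proof.
move=> fE /dvdpP[c pE] [s [k /(congr1 (arc u v))]].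
rewrite fE rmorphD rmorphM rmorph_sum /= pE => e.
have /sumsq_low_coef_ge0 : \sum_(h <- [seq arc u v h | h <- s]) h ^+ 2 =
    (- 1 - arc u v k * c * 'X) * 'X^(2 * m).
  rewrite big_map mulrBl mulN1r -!mulrA -exprS e addrK.
  by apply: eq_bigr => h _; rewrite rmorphXn.
by rewrite !hornerE subr0 oppr_ge0 ler10.
Qed.

(** The sums of squares weighted by [p] and by [- p] enter as one multiple
    of [p], whose cofactor is the difference of the two sums. *)
Lemma trunc_qmodule_sos_mod p (n : nat) f :
  trunc_qmodule [:: p; - p] n f -> sos_mod p f.
Proof.
case=> F [_ ->]; rewrite /= !big_ord_recl big_ord0 /=.
rewrite addr0 -!mulr_sumr.
eexists (F ord0), (_ - _).
by rewrite mul1r mulrBl !(mulrC _ p) mulNr.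
Qed.

Lemma pclass_sos_mod p f : sum_of_squares (pclass p f) -> sos_mod p f.
Proof.
case=> s sE; exists [seq repr b | b <- s].
have /coord_eqP[k kE] : pclass p f = pclass p (\sum_(b <- s) repr b ^+ 2).
  rewrite sE rmorph_sum /=; apply: eq_bigr => b _.
  by rewrite rmorphXn /= /pclass reprK.
by exists k; rewrite big_map -kE addrC subrK.
Qed.

End Arc.

(** When only one of [l1], [l2] is odd, the cusp gives the variable with the
    odd exponent weight 2 and the other one weight 3.  Since an odd exponent
    above 1 is at least 3, the monomials of [x ^ l1 - y ^ l2] have orders at
    least [2 * 3] and [3 * 2] on it.  The weights 2 and 3 are chosen to
    make both bounds equal to 6. *)
Lemma cusp_weight2_dvd (R : realType) (a : nat) :
  (2 < a)%N -> ('X^6 : {poly R}) %| (- 'X^2) ^+ a.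
Proof.
move=> a3; rewrite exprNn dvdp_mull // -exprM dvdp_exp2l //.
by rewrite (leq_mul2l 2 3).
Qed.

Lemma cusp_weight3_dvd (R : realType) (b : nat) :
  (1 < b)%N -> ('X^6 : {poly R}) %| ('X^3) ^+ b.
Proof. by move=> b2; rewrite -exprM dvdp_exp2l // (leq_mul2l 3 2). Qed.

Lemma odd_gt2 (n : nat) : odd n -> (1 < n)%N -> (2 < n)%N.
Proof. by case: n => [|[|[|]]]. Qed.

Section Sign.
Variable R : realType.
Implicit Types (x y : R) (a b : nat).

Lemma eval2X (v : R * R) : eval2 varX v = v.1.
Proof. by rewrite /eval2 mevalXU. Qed.

Lemma eval2Y (v : R * R) : eval2 varY v = v.2.
Proof. by rewrite /eval2 mevalXU. Qed.

Lemma eval2M (g h : {mpoly R[2]}) (v : R * R) :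
  eval2 (g * h) v = eval2 g v * eval2 h v.
Proof. exact: mevalM. Qed.

Lemma eval2B (g h : {mpoly R[2]}) (v : R * R) :
  eval2 (g - h) v = eval2 g v - eval2 h v.
Proof. exact: mevalB. Qed.

Lemma eval2Xn (g : {mpoly R[2]}) (v : R * R) (n : nat) :
  eval2 (g ^+ n) v = eval2 g v ^+ n.
Proof. exact: rmorphXn. Qed.

Definition eval2E := (eval2M, eval2B, eval2Xn, eval2X, eval2Y).

Lemma odd_even_power_eq_ge0 x y a b :
  odd a -> ~~ odd b -> x ^+ a = y ^+ b -> 0 <= x.
Proof. by move=> oa eb e; rewrite -(exprn_odd_ge0 _ oa) e exprn_even_ge0. Qed.

Lemma odd_odd_power_eq_mul_ge0 x y a b :
  odd a -> odd b -> x ^+ a = y ^+ b -> 0 <= x * y.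
Proof.
move=> oa ob e; case: (leP 0 x) => [x0|/ltW x0].
  by rewrite mulr_ge0 // -(exprn_odd_ge0 _ ob) -e exprn_ge0.
by rewrite mulr_le0 // -(exprn_odd_le0 _ ob) -e exprn_odd_le0.
Qed.

End Sign.

Lemma witness_ge0 (R : realType) (l1 l2 : nat) (q : {mpoly R[2]})
    (v : R * R) :
    (odd l1 || odd l2) -> q \in [:: varX; varY; varX * varY] ->
    v \in zero_set (q * (varX ^+ l1 - varY ^+ l2)) ->
  0 <= eval2 (witness l1 l2 q) v.
Proof.
move=> odd12 q_in; rewrite inE /= eval2M mulf_eq0 => /orP[/eqP q0|].
  have xy0 : v.1 * v.2 = 0.
    by move: q_in q0; rewrite !inE => /or3P[] /eqP->; rewrite !eval2E => // ->;
      rewrite ?mul0r ?mulr0.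
  rewrite /witness; case: ifP => _; last case: ifP => _.
  - case: eqP => [<-|_]; first by rewrite q0.
    by rewrite !eval2E expr2 mulrA xy0 mul0r.
  - case: eqP => [<-|_]; first by rewrite q0.
    by rewrite !eval2E expr2 -mulrA xy0 mulr0.
  by rewrite !eval2E xy0.
rewrite !eval2E subr_eq0 => /eqP e.
rewrite /witness; case: ifP => [/andP[o1 e2]|].
  have x0 := odd_even_power_eq_ge0 o1 e2 e.
  by case: ifP => _; rewrite !eval2E // mulr_ge0 // sqr_ge0.
case: ifP => [/andP[e1 o2] _|].
  have y0 := odd_even_power_eq_ge0 o2 e1 (esym e).
  by case: ifP => _; rewrite !eval2E // mulr_ge0 // sqr_ge0.
move: odd12; case o1: (odd l1); case o2: (odd l2) => //= _ _ _.
rewrite !eval2E; exact: odd_odd_power_eq_mul_ge0 e.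
Qed.

(** Suppose only one exponent is odd.  On its cusp, the witness equals
    [- 'X ^+ 2] when [q] is the coordinate of weight 2, while [p] has order at
    least [2 + 6]; otherwise the witness equals [- 'X ^+ 8], the factor [q] is
    a multiple of the coordinate of weight 3, and [p] has order at least
    [3 + 6]. *)
Lemma witness_not_sos_mod (R : realType) (l1 l2 : nat) (q : {mpoly R[2]}) :
    (1 < l1)%N -> (1 < l2)%N -> (odd l1 || odd l2) ->
    q \in [:: varX; varY; varX * varY] ->
  ~ sos_mod (q * (varX ^+ l1 - varY ^+ l2)) (witness l1 l2 q).
Proof.
move=> l1_gt1 l2_gt1 odd12 q_in.
rewrite /witness; case: ifP => [/andP[o1 _]|].
  have d6 : 'X^6 %| arc (- 'X^2) 'X^3 (varX ^+ l1 - varY ^+ l2 : {mpoly R[2]}).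
    rewrite rmorphB !rmorphXn /= arcX arcY.
    by rewrite dvdp_sub ?cusp_weight2_dvd ?cusp_weight3_dvd ?odd_gt2.
  case: eqP => [qE|qX].
    apply: (@arc_obstruction _ (- 'X^2) 'X^3 _ _ 1); first by rewrite arcX.
    by rewrite rmorphM /= dvdp_mull // (dvdp_trans _ d6) // dvdp_exp2l.
  apply: (@arc_obstruction _ (- 'X^2) 'X^3 _ _ 4).
    by rewrite rmorphM rmorphXn /= arcX arcY mulNr -exprM -exprD.
  rewrite rmorphM /= (exprD _ 3 6) dvdp_mul //.
  move: q_in qX; rewrite !inE => /or3P[] /eqP-> // _;
    by rewrite ?rmorphM /= arcY // dvdp_mull.
case: ifP => [/andP[_ o2] _|].
  have d6 : 'X^6 %| arc 'X^3 (- 'X^2) (varX ^+ l1 - varY ^+ l2 : {mpoly R[2]}).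
    rewrite rmorphB !rmorphXn /= arcX arcY.
    by rewrite dvdp_sub ?cusp_weight2_dvd ?cusp_weight3_dvd ?odd_gt2.
  case: eqP => [qE|qY].
    apply: (@arc_obstruction _ 'X^3 (- 'X^2) _ _ 1); first by rewrite arcY.
    by rewrite rmorphM /= dvdp_mull // (dvdp_trans _ d6) // dvdp_exp2l.
  apply: (@arc_obstruction _ 'X^3 (- 'X^2) _ _ 4).
    by rewrite rmorphM rmorphXn /= arcX arcY mulrN -exprM -exprD.
  rewrite rmorphM /= (exprD _ 3 6) dvdp_mul //.
  move: q_in qY; rewrite !inE => /or3P[] /eqP-> // _;
    by rewrite ?rmorphM /= arcX // dvdp_mulr.
move=> _ _; apply: (@arc_obstruction _ 'X (- 'X) _ _ 1).
  by rewrite rmorphM /= arcX arcY mulrN.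
rewrite rmorphM /= (exprD _ 1 2) dvdp_mul //.
  move: q_in; rewrite !inE expr1 => /or3P[] /eqP->;
    by rewrite ?rmorphM /= ?arcX ?arcY ?mulrN ?dvdpNr // dvdp_mulr.
rewrite rmorphB !rmorphXn /= arcX arcY.
apply: dvdp_sub; first exact: dvdp_exp2l.
by rewrite exprNn; apply: dvdp_mull; exact: dvdp_exp2l.
Qed.

Theorem corollary3p7 (R : realType) (l1 l2 : nat) (q : {mpoly R[2]})
    (l1_gt1 : (1 < l1)%N) (l2_gt1 : (1 < l2)%N) (l12 : gcdn l1 l2 = 1%N)
    (q_in : q \in [:: varX; varY; varX * varY]) :
  let p : {mpoly R[2]} := q * (varX ^+ l1 - varY ^+ l2) in
  let f : {mpoly R[2]} := witness l1 l2 q in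
  [/\ forall v : R * R, v \in zero_set p -> 0 <= eval2 f v,
      forall n : nat, (0 < n)%N -> ~ trunc_qmodule [:: p; - p] n f
    & ~ sum_of_squares (pclass p f)].
Proof.
move=> p f.
have odd12 : odd l1 || odd l2.
  by rewrite -[_ || _]negbK negb_or -!dvdn2 -dvdn_gcd l12.
have f_not_sos : ~ sos_mod p f by apply: witness_not_sos_mod.
split=> [v|n _ /trunc_qmodule_sos_mod|/pclass_sos_mod] //.
exact: witness_ge0.
Qed.
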